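(* Let $\boldsymbol{v}=(v_1,v_2,\ldots,v_k)$ be a $k$-tuple of positive integers, let $m$ be a nonnegative integer, and let $p,x$ be real numbers with $p\ge 1$ and $x+1>0$. Then $$\mathcal Z^{\boldsymbol v}_p(m+1;x)=\sum_{1\le n_1<n_2<\cdots<n_k} B(n_k,1+x)\,\frac{P_m\left(H_{n_k}^{(1)}(x),\ldots,H_{n_k}^{(m)}(x)\right)}{p^{n_k}\,n_1^{v_1}n_2^{v_2}\cdots n_k^{v_k}}.$$
   Context: For a $k$-tuple $\boldsymbol v=(v_1,\ldots,v_k)$ of positive integers, real $p\ge 1$, real $x>-1$ and complex $s$ with $\Re(s)>1-k$, define $$\mathcal Z^{\boldsymbol v}_p(s;x)=\frac{1}{\Gamma(s)}\int_0^\infty \frac{e^{-xt}}{e^t-1}\,Li_{\boldsymbol v}\left(\frac{1-e^{-t}}{p}\right)t^{s-1}\,dt,\qquad Li_{\boldsymbol v}(z)=\sum_{1\le n_1<n_2<\cdots<n_k}\frac{z^{n_k}}{n_1^{v_1}n_2^{v_2}\cdots n_k^{v_k}}.$$ $B(\cdot,\cdot)$ is the Euler beta function. For $n\ge 1$, $H_n^{(s)}(x)=\sum_{j=1}^n (j+x)^{-s}$. The modified Bell polynomials $P_m(x_1,\ldots,x_m)$ are defined by $$\exp\left(\sum_{k=1}^\infty\frac{x_k}{k}z^k\right)=\sum_{m=0}^\infty P_m(x_1,\ldots,x_m)z^m$$ (so $P_0=1$). *)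

(* Defs.v *)
From mathcomp Require Import all_boot all_order all_algebra.
From mathcomp Require Import all_classical all_reals all_analysis.
From mathcomp Require Import complex.

Set Implicit Arguments.
Unset Strict Implicit.
Unset Printing Implicit Defensive.

Import Order.TTheory GRing.Theory Num.Theory.
Import numFieldNormedType.Exports.

Local Open Scope classical_set_scope.
Local Open Scope ring_scope.
Local Open Scope complex_scope.

Section ComplexAnalysis.
Context {R : realType}.
Local Notation mu := (@lebesgue_measure R).

(* t ^ z = exp (z ln t) for t > 0 *)
Definition cpow (t : R) (z : R[i]) : R[i] :=
  (expR (complex.Re z * ln t) * cos (complex.Im z * ln t)) +i*
  (expR (complex.Re z * ln t) * sin (complex.Im z * ln t)).

Definition cintegral (D : set R) (f : R -> R[i]) : R[i] :=
  (\int[mu]_(t in D) complex.Re (f t)) +i* (\int[mu]_(t in D) complex.Im (f t)).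

Definition gamma_integral (z : R[i]) : R[i] :=
  cintegral `]0, +oo[ (fun t => (expR (- t))%:C * cpow t (z - 1)).

(* The meromorphic continuation Gamma(z) = Gamma(z + n) / (z ... (z + n - 1)),
   where n is the least natural number such that Re z + n > 0 (n = 0 if
   Re z > 0). At the poles the value is 0, hence so is that of 1 / Gamma. *)
Definition gamma (z : R[i]) : R[i] :=
  let n := Num.truncn (1 - complex.Re z) in
  gamma_integral (z + n%:R) / \prod_(j < n) (z + j%:R).

End ComplexAnalysis.

Section Sums.
Context {R : realType}.

(* Sum of an absolutely summable family; the subtraction is needed since
   [esum] computes the sum of a nonnegative family only. *)
Definition rsum (T : choiceType) (D : set T) (f : T -> R) : R :=
  fine (esum D (EFin \o f)^\+ - esum D (EFin \o f)^\-)%E.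

(* 1 <= n_1 < ... < n_k *)
Definition increasing_tuples (k : nat) : set (k.-tuple nat) :=
  [set n : k.-tuple nat | path ltn 0%N n].

Definition tuple_weight (k : nat) (v n : k.-tuple nat) : R :=
  \prod_(i < k) (tnth n i)%:R ^+ tnth v i.

Definition polylog (k : nat) (v : k.-tuple nat) (z : R) : R :=
  rsum (@increasing_tuples k) (fun n => z ^+ last 0%N n / tuple_weight v n).

Definition mzeta (k : nat) (v : k.-tuple nat) (p : R) (s : R[i]) (x : R) :
    R[i] :=
  (gamma s)^-1 *
  cintegral `]0, +oo[ (fun t =>
    (expR (- (x * t)) / (expR t - 1) *
       polylog v ((1 - expR (- t)) / p))%:C * cpow t (s - 1)).

Definition euler_beta (a b : R) : R :=
  \int[@lebesgue_measure R]_(t in `]0, 1[) (t `^ (a - 1) * (1 - t) `^ (b - 1)).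

Definition harmonic_shift (n s : nat) (x : R) : R :=
  \sum_(1 <= j < n.+1) (j%:R + x) ^- s.

End Sums.

Section ModifiedBell.
Context {R : realType}.

(* exp (sum_(k >= 1) x_k / k z^k), with both the exponential series and its
   argument truncated after the N-th power. *)
Definition bell_gen (N : nat) (x : nat -> R) : {poly R} :=
  \sum_(j < N.+1) j`!%:R^-1 *:
    (\sum_(1 <= k < N.+1) (x k / k%:R) *: 'X^k) ^+ j.

(* P_m (x 1, ..., x m); by [coef_bell_gen], the truncation at order m does not
   affect the coefficient of z^m. *)
Definition modified_bell (m : nat) (x : nat -> R) : R := (bell_gen m x)`_m.

Lemma coef_bell_gen (N m : nat) (x : nat -> R) :
  (m <= N)%N -> (bell_gen N x)`_m = modified_bell m x.
Proof.
pose g n : {poly R} := \sum_(1 <= k < n.+1) (x k / k%:R) *: 'X^k.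
have gE n i : (g n)`_i = if (0 < i <= n)%N then x i / i%:R else 0.
  rewrite /g coef_sum; under eq_bigr do rewrite coefZ coefXn.
  have [/andP[i0 il]|iN] := boolP (0 < i <= n)%N.
    rewrite (bigD1_seq i) ?mem_index_iota ?iota_uniq ?i0//= eqxx mulr1.
    by rewrite big1 ?addr0// => k /negPf ki; rewrite eq_sym ki mulr0.
  rewrite big_nat_cond big1// => k; rewrite andbT => kn.
  by case: eqP => [ik|]; rewrite ?mulr0//; rewrite ik -(ltnS k) kn in iN.
move=> mN; rewrite /modified_bell /bell_gen -!/(g _) !coef_sum.
have powE j i : (i <= m)%N -> (g N ^+ j)`_i = (g m ^+ j)`_i.
  elim: j i => [//|j IH] i im; rewrite !exprS !coefM; apply: eq_bigr => l _.
  have lm : (l <= m)%N by rewrite (leq_trans _ im)// -ltnS.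
  rewrite !gE lm (leq_trans lm mN) IH//.
  exact: leq_trans (leq_subr _ _) im.
have pow0 j i : (i < j)%N -> (g m ^+ j)`_i = 0.
  elim: j i => [//|j IH] i ij; rewrite exprS coefM big1// => l _.
  rewrite gE; case: ifPn => [/andP[l0 _]|]; last by rewrite mul0r.
  have li : (l <= i)%N by rewrite -ltnS.
  rewrite IH ?mulr0//; rewrite ltnS in ij; apply: leq_trans ij.
  by rewrite ltn_subrL l0 (leq_trans l0 li).
under eq_bigr do rewrite coefZ powE//.
rewrite -(big_mkord xpredT (fun j => j`!%:R^-1 * (g m ^+ j)`_m)).
rewrite (big_cat_nat (n := m.+1))//= [X in _ + X]big_nat_cond [X in _ + X]big1 ?addr0; last first.
  by move=> j; rewrite andbT => /andP[mj _]; rewrite pow0// mulr0.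
by rewrite big_mkord; apply: eq_bigr => j _; rewrite coefZ.
Qed.

End ModifiedBell.

(* Main.v *)
Require Import Defs.
From mathcomp Require Import all_boot all_order all_algebra.
From mathcomp Require Import all_classical all_reals all_analysis.
From mathcomp Require Import complex ring lra zify measurable_realfun.

(** Write [a = 1 + x]. For [t > 0] the kernel [exp (- x t) / (exp t - 1)] equals
    [exp (- a t) / (1 - exp (- t))], so that expanding the polylogarithm turns
    the integrand into a sum, over increasing tuples of last entry [N + 1], of
    nonnegative multiples of
      [t ^ m exp (- a t) (1 - exp (- t)) ^ N]
    and the theorem follows from integrating term by term.

    Each term has a closed form. By the binomial theorem and
    [int_0^oo t ^ m exp (- c t) dt = m! / c ^ (m + 1)] its integral is [m!]
    times [D N m = sum_i (-1) ^ i C(N, i) / (a + i) ^ (m + 1)]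
    ([integral_powM_expR_onem]), and the same expansion of the beta integral
    gives [B (N + 1, a) = D N 0] ([euler_betaE]). Writing [a + N + 1] as
    [(a + i) + (N + 1 - i)] in each summand yields
      [(a + N + 1) D (N + 1) (m + 1) = (N + 1) D N (m + 1) + D (N + 1) m]
    ([alt_bin_sum_pascal]). On the other side, adding the powers [c ^ s] to the
    arguments of the Bell polynomials multiplies their generating function by
    [1 / (1 - c z)], which gives
      [P_(m + 1) (y) = P_(m + 1) (x) + c P_m (y)], [y_s = x_s + c ^ s]
    ([modified_bell_add_powers]). With [c = 1 / (a + N + 1)] the two recurrences
    coincide, whence [D N m = D N 0 * P_m (H_(N + 1))] ([alt_bin_sum_bell]).

    The interchange of sum and integral is Tonelli's theorem
    ([integral_esum]), valid in [[0, +oo]]. It remains to see that the common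
    value is finite. Let [z = 1 - exp (- t)]. Since [sum_(j >= 1) z ^ j / j = t],
    and since the denominator [n_i] is at least the gap [n_i - n_(i-1)], summing
    over the entries from the last one down to the first bounds the
    polylogarithm by [t ^ k] ([esum_increasing_tuples_le]). As
    [t / (1 - exp (- t)) <= 1 + t] and [k > 0], the integrand is at most
    [(1 + t) t ^ (m + k - 1) exp (- a t)], which is integrable
    ([esum_mzeta_term_le]). *)

Set Implicit Arguments.
Unset Strict Implicit.
Unset Printing Implicit Defensive.

Import Order.TTheory GRing.Theory Num.Theory.
Import numFieldNormedType.Exports.

Local Open Scope classical_set_scope.
Local Open Scope ring_scope.
Local Open Scope complex_scope.

(** * Recurrence for the modified Bell polynomials *)

Lemma modified_bell0 (R : realType) (x : nat -> R) : modified_bell 0 x = 1.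
Proof.
by rewrite /modified_bell /bell_gen big_ord1 expr0 fact0 invr1 scale1r coefC.
Qed.

(** Newton's identity: with [g = sum_k x_k / k z ^ k], compare the coefficients
    of [z ^ m] in [(exp g)' = g' exp g]. *)
Lemma modified_bell_newton (R : realType) (m : nat) (x : nat -> R) :
  m.+1%:R * modified_bell m.+1 x =
  \sum_(k < m.+1) x k.+1 * modified_bell (m - k) x.
Proof.
pose g : {poly R} := \sum_(1 <= k < m.+2) (x k / k%:R) *: 'X^k.
have gE i : g`_i = if (0 < i <= m.+1)%N then x i / i%:R else 0.
  rewrite /g coef_sum; under eq_bigr do rewrite coefZ coefXn.
  have [/andP[i0 il]|iN] := boolP (0 < i <= m.+1)%N.
    rewrite (bigD1_seq i) ?mem_index_iota ?iota_uniq ?i0//= eqxx mulr1.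
    by rewrite big1 ?addr0// => k /negPf ki; rewrite eq_sym ki mulr0.
  rewrite big_nat_cond big1// => k; rewrite andbT => kn.
  by case: eqP => [ik|]; rewrite ?mulr0//; rewrite ik -(ltnS k) kn in iN.
have pow0 j i : (i < j)%N -> (g ^+ j)`_i = 0.
  elim: j i => [//|j IH] i ij; rewrite exprS coefM big1// => l _.
  rewrite gE; case: ifPn => [/andP[l0 _]|]; last by rewrite mul0r.
  have li : (l <= i)%N by rewrite -ltnS.
  rewrite IH ?mulr0//; rewrite ltnS in ij; apply: leq_trans ij.
  by rewrite ltn_subrL l0 (leq_trans l0 li).
(* Differentiating the truncated exponential loses its top term, but the
   coefficient of z^m does not see it: g has no constant term. *)
have dg : (bell_gen m.+1 x)^`() = \sum_(j < m.+1) j`!%:R^-1 *: (g^`() * g ^+ j).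
  rewrite /bell_gen -/g linear_sum big_ord_recl /= expr0 linearZ /= derivC.
  rewrite scaler0 add0r; apply: eq_bigr => j _.
  rewrite linearZ /= deriv_exp /= -scalerMnr scalerMnl -mulr_natr.
  by rewrite factS natrM invfM mulrAC mulVf ?mul1r// pnatr_eq0.
have -> : m.+1%:R * modified_bell m.+1 x = (bell_gen m.+1 x)^`()`_m.
  by rewrite coef_deriv mulr_natl.
have -> : (bell_gen m.+1 x)^`()`_m = (g^`() * bell_gen m.+1 x)`_m.
  rewrite dg /bell_gen -/g [in RHS]big_ord_recr /= mulrDr coefD.
  have top0 : (g^`() * g ^+ m.+1)`_m = 0.
    by rewrite coefM big1// => i _; rewrite pow0 ?mulr0// ltnS leq_subr.
  rewrite -scalerAr coefZ top0 mulr0 addr0.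
  rewrite mulr_sumr !coef_sum; apply: eq_bigr => j _.
  by rewrite -scalerAr.
rewrite coefM; apply: eq_bigr => k _; congr (_ * _).
  by rewrite coef_deriv gE /= ltn_ord -[LHS]mulr_natr divfK ?pnatr_eq0.
by rewrite coef_bell_gen// (leq_trans (leq_subr _ _)).
Qed.

Lemma modified_bell_const0 (R : realType) (m : nat) :
  modified_bell m.+1 (fun=> 0 : R) = 0.
Proof.
have := modified_bell_newton m (fun=> 0 : R).
rewrite big1 => [/eqP|k _]; last by rewrite mul0r.
by rewrite mulf_eq0 pnatr_eq0/= => /eqP.
Qed.

(** Since [exp (sum_k c ^ k / k z ^ k) = 1 / (1 - c z)], the generating functions
    satisfy [(1 - c z) G_y = G_x]; here this is derived by induction from
    Newton's identity, applied to both [x] and [y]. *)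
Lemma modified_bell_add_powers (R : realType) (m : nat) (x : nat -> R) (c : R) :
  let y s := x s + c ^+ s in
  modified_bell m.+1 y = modified_bell m.+1 x + c * modified_bell m y.
Proof.
move=> y; elim/ltn_ind: m => m IH.
have nz : m.+1%:R != 0 :> R by rewrite pnatr_eq0.
apply: (mulfI nz); rewrite modified_bell_newton.
rewrite (eq_bigr (fun k : 'I_m.+1 => x k.+1 * modified_bell (m - k) y
   + c ^+ k.+1 * modified_bell (m - k) y)); last by move=> k _; rewrite mulrDl.
rewrite big_split/= mulrDr modified_bell_newton big_ord_recr/= subnn.
rewrite (eq_bigr (fun k : 'I_m => x k.+1 * modified_bell (m - k) x
   + c * (x k.+1 * modified_bell (m - k.+1) y))); last first.
  move=> k _; have km := ltn_ord k.
  rewrite -[(m - k)%N]prednK ?subn_gt0// -subnS IH; last by lia.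
  by ring.
rewrite big_split/= -mulr_sumr modified_bell0.
rewrite [\sum_(k < m.+1) x k.+1 * modified_bell (m - k) x]big_ord_recr/= subnn.
rewrite modified_bell0.
rewrite big_ord_recl/= expr1 subn0.
rewrite [X in _ + (_ + X)](eq_bigr (fun k : 'I_m =>
    c * (c ^+ k.+1 * modified_bell (m - k.+1) y))); last first.
  by move=> k _; rewrite exprS mulrA.
rewrite -mulr_sumr.
(* What is left is Newton's identity for [y] at order [m]. *)
suff key : m%:R * modified_bell m y =
  \sum_(k < m) x k.+1 * modified_bell (m - k.+1) y +
  \sum_(k < m) c ^+ k.+1 * modified_bell (m - k.+1) y.
  have -> : m.+1%:R * (c * modified_bell m y) =
      c * (m%:R * modified_bell m y) + c * modified_bell m y.
    by rewrite -natr1; ring.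
  by rewrite key; ring.
case: m {IH nz} => [|m]; first by rewrite !big_ord0 mul0r addr0.
rewrite modified_bell_newton -big_split/=; apply: eq_bigr => k _.
by rewrite subSS /y mulrDl.
Qed.

Lemma harmonic_shiftS (R : realType) (n s : nat) (x : R) :
  harmonic_shift n.+1 s x = harmonic_shift n s x + (n.+1%:R + x)^-1 ^+ s.
Proof. by rewrite /harmonic_shift big_nat_recr//= exprVn. Qed.

Lemma modified_bell_harmonic_shiftS (R : realType) (n m : nat) (x : R) :
  let P N M := modified_bell M (fun s => harmonic_shift N s x) in
  P n.+1 m.+1 = P n m.+1 + (n.+1%:R + x)^-1 * P n.+1 m.
Proof.
rewrite /=; under [in LHS]eq_fun do rewrite harmonic_shiftS.
under [in X in _ = _ + _ * X]eq_fun do rewrite harmonic_shiftS.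
exact: modified_bell_add_powers.
Qed.

(** * Alternating binomial sums *)

(** By partial fractions, [alt_bin_sum N m a] is [(-1) ^ m / m!] times the [m]-th
    derivative of [B (N + 1, .)] at [a]. *)
Definition alt_bin_sum (R : realType) (N m : nat) (a : R) : R :=
  \sum_(i < N.+1) (-1) ^+ i * 'C(N, i)%:R / (a + i%:R) ^+ m.+1.

Lemma sum_signed_bin (R : realType) (N : nat) :
  \sum_(i < N.+2) (-1) ^+ i * 'C(N.+1, i)%:R = 0 :> R.
Proof.
transitivity ((1 - 1) ^+ N.+1 : R); last by rewrite subrr expr0n.
by rewrite exprDn; apply: eq_bigr => i _; rewrite expr1n mul1r mulr_natr.
Qed.

(** Write [a + N + 1 = (a + i) + (N + 1 - i)] in the [i]-th summand: the first
    part lowers the exponent, the second absorbs into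
    [(N + 1 - i) C(N + 1, i) = (N + 1) C(N, i)]. The last sum is
    [alt_bin_sum N.+1 m.-1 a] if [m > 0], and vanishes if [m = 0]. *)
Lemma alt_bin_sum_pascal (R : realType) (N m : nat) (a : R) : 0 < a ->
  (a + N.+1%:R) * alt_bin_sum N.+1 m a = N.+1%:R * alt_bin_sum N m a +
  \sum_(i < N.+2) (-1) ^+ i * 'C(N.+1, i)%:R / (a + i%:R) ^+ m.
Proof.
move=> a0; have ai (i : nat) : a + i%:R != 0 by rewrite gt_eqF// ltr_pwDl.
have -> : N.+1%:R * alt_bin_sum N m a = \sum_(i < N.+2) (N.+1 - i)%:R *
    ((-1) ^+ i * 'C(N.+1, i)%:R / (a + i%:R) ^+ m.+1).
  rewrite big_ord_recr/= subnn mul0r addr0 /alt_bin_sum mulr_sumr.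
  apply: eq_bigr => i _; rewrite -!mulrA mulrCA [RHS]mulrCA; congr (_ * _).
  by rewrite !mulrA -!natrM mul_bin_down.
rewrite /alt_bin_sum mulr_sumr -big_split/=; apply: eq_bigr => i _.
have iN : (i <= N.+1)%N by rewrite -ltnS.
rewrite natrB// exprS; have := ai i; set d := a + i%:R => d0.
by have -> : a = d - i%:R; [rewrite /d; ring | field; rewrite expf_neq0].
Qed.

(** With [a = 1 + x], both sides obey the recurrence
    [(a + N + 1) u (N + 1) (m + 1) = (N + 1) u N (m + 1) + u (N + 1) m]. *)
Lemma alt_bin_sum_bell (R : realType) (N m : nat) (x : R) : 0 < 1 + x ->
  alt_bin_sum N m (1 + x) =
  alt_bin_sum N 0 (1 + x) * modified_bell m (fun s => harmonic_shift N.+1 s x).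
Proof.
move=> a0; case: m => [|m]; first by rewrite modified_bell0 mulr1.
elim: N m => [|N IHN] m.
  have E j : alt_bin_sum 0 j (1 + x) = ((1 + x) ^+ j.+1)^-1.
    by rewrite /alt_bin_sum big_ord1 expr0 bin0 !mul1r addr0.
  have H0 : (fun s => harmonic_shift 0 s x) = fun=> 0.
    by apply/funext => s; rewrite /harmonic_shift big_geq.
  elim: m => [|m IHm];
    rewrite modified_bell_harmonic_shiftS H0 modified_bell_const0 add0r.
    by rewrite modified_bell0 mulr1 !E expr1 expr2 invfM.
  by rewrite mulrCA -IHm !E exprS invfM.
have aN : 1 + x + N.+1%:R != 0 by rewrite gt_eqF// ltr_pwDl.
have aE : N.+2%:R + x = 1 + x + N.+1%:R by rewrite -addn1 natrD; ring.
have D0 : alt_bin_sum N.+1 0 (1 + x) =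
    N.+1%:R * alt_bin_sum N 0 (1 + x) / (1 + x + N.+1%:R).
  apply: (mulfI aN); rewrite alt_bin_sum_pascal// [RHS]mulrC divfK//.
  under [X in _ + X]eq_bigr do rewrite expr0 divr1.
  by rewrite sum_signed_bin addr0.
have rec j : alt_bin_sum N.+1 j.+1 (1 + x) =
    (N.+1%:R * alt_bin_sum N j.+1 (1 + x) + alt_bin_sum N.+1 j (1 + x)) /
    (1 + x + N.+1%:R).
  by apply: (mulfI aN); rewrite alt_bin_sum_pascal// [RHS]mulrC divfK.
move: (1 + x + N.+1%:R) aN aE D0 rec => d d0 dE D0 rec.
elim: m => [|m IHm]; rewrite rec IHN (modified_bell_harmonic_shiftS N.+1) dE.
  by rewrite modified_bell0 D0; field.
by rewrite IHm D0; field.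
Qed.

(** * Gamma and beta integrals *)

Lemma onem_expRN_gt0 (R : realType) (t : R) : 0 < t -> 0 < 1 - expR (- t).
Proof. by move=> t0; rewrite subr_gt0 -expR0 ltr_expR oppr_lt0. Qed.

Lemma onem_expRN_ge0 (R : realType) (t : R) : 0 <= t -> 0 <= 1 - expR (- t).
Proof. by move=> t0; rewrite subr_ge0 -expR0 ler_expR oppr_le0. Qed.

(** One term of the exponential series suffices:
    [exp (c t) >= (c t) ^ (m + 1) / (m + 1)!], so that the function is [O (1 / t)]. *)
Lemma cvgy_powM_expR (R : realType) (m : nat) (c : R) : 0 < c ->
  (fun t : R => t ^+ m * expR (- (c * t))) t @[t --> +oo] --> (0 : R).
Proof.
move=> c0; pose K := m.+1`!%:R / c ^+ m.+1.
apply: (@squeeze_cvgr _ _ _ _ (cst 0) (fun t => K * t^-1)).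
- near=> t.
  have t0 : 0 < t by near: t; apply: nbhs_pinfty_gt; rewrite num_real.
  apply/andP; split; first by rewrite mulr_ge0 ?expR_ge0 ?exprn_ge0 1?ltW//=.
  rewrite expRN ler_pdivrMr ?expR_gt0//.
  have f0 : 0 < m.+1`!%:R :> R by rewrite ltr0n fact_gt0.
  have Kt0 : 0 < K * t^-1 by rewrite mulr_gt0 ?divr_gt0 ?exprn_gt0 ?invr_gt0.
  rewrite -ler_pdivrMl//; apply: le_trans (expR_ge1Dxn m (ltW (mulr_gt0 c0 t0))).
  apply: (@le_trans _ _ ((c * t) ^+ m.+1 / m.+1`!%:R)); last by rewrite lerDr.
  rewrite [leLHS](_ : _ = (c * t) ^+ m.+1 / m.+1`!%:R)//.
  rewrite /K exprMn [t ^+ m.+1]exprS; field.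
  by rewrite !gt_eqF ?exprn_gt0.
- exact: cvg_cst.
- rewrite -(mulr0 K); apply: cvgMr; apply/gtr0_cvgV0 => //; exact: nbhs_pinfty_gt.
Unshelve. all: by end_near. Qed.

Lemma is_derive_expRNM (R : realType) (c t : R) :
  is_derive t 1 (fun t => expR (- (c * t))) (- (c * expR (- (c * t)))).
Proof.
have h : is_derive t 1 (fun t => - (c * t)) (- c).
  by apply: is_derive_eq; rewrite -[RHS]mulr1 mulNr.
have := is_derive1_comp (f := expR) (x := t) (is_derive_expR _) h.
by move=> /is_derive_eq; apply; rewrite mulrN mulrC.
Qed.

(** The primitive vanishing at infinity, by repeated integration by parts:
    [c F_(m + 1) = (m + 1) F_m - t ^ (m + 1) exp (- c t)]. *)
Lemma powM_expR_primitive (R : realType) (m : nat) (c : R) : 0 < c ->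
  exists F : R -> R,
    [/\ forall t : R, is_derive t 1 F (t ^+ m * expR (- (c * t))),
        F t @[t --> +oo] --> (0 : R) & F 0 = - (m`!%:R / c ^+ m.+1)].
Proof.
move=> c0; have c1 : c != 0 by rewrite gt_eqF.
elim: m => [|m [F [dF Foo F0]]].
  exists (fun t => - c^-1 * expR (- (c * t))); split.
  - move=> t; have d := is_derive_expRNM c t.
    have := @is_deriveZ _ _ _ _ (- c^-1) _ _ _ d.
    by move=> /is_derive_eq; apply; rewrite /GRing.scale/= expr0; field.
  - rewrite [X in _ --> X](_ : 0 = - c^-1 * 0); last by rewrite mulr0.
    apply: cvgMl_tmp.
    by have := cvgy_powM_expR 0 c0; under eq_fun do rewrite expr0 mul1r.
  - by rewrite mulr0 oppr0 expR0 mulr1 fact0 mul1r.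
exists (fun t => c^-1 * (m.+1%:R * F t - t ^+ m.+1 * expR (- (c * t)))); split.
- move=> t; have d := is_derive_expRNM c t.
  have dm := @is_deriveX _ _ id m.+1 t 1 1 (is_derive_id t (1 : R)).
  have {}dm : is_derive t 1 (fun t => t ^+ m.+1) (m.+1%:R * t ^+ m).
    rewrite (_ : (fun t => _) = id ^+ m.+1); last first.
      by apply/funext => u; rewrite exprfctE.
    by apply: is_derive_eq dm _; rewrite /GRing.scale/= mulr1.
  have dFt := dF t; apply: is_derive_eq; rewrite /GRing.scale/=.
  by rewrite -mulr_natl; field.
- rewrite [X in _ --> X](_ : 0 = c^-1 * (m.+1%:R * 0 - 0)); last first.
    by rewrite mulr0 subr0 mulr0.
  apply: cvgMl_tmp; apply: cvgB; last exact: cvgy_powM_expR.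
  exact: cvgMl_tmp.
- rewrite F0 expr0n mul0r subr0 factS natrM [c ^+ m.+2]exprS; field.
  by rewrite c1 expf_neq0.
Qed.

Lemma integral_powM_expR (R : realType) (m : nat) (c : R) : 0 < c ->
  (\int[lebesgue_measure]_(t in `]0%R, +oo[) (t ^+ m * expR (- (c * t)))%:E
   = (m`!%:R / c ^+ m.+1)%:E)%E.
Proof.
move=> c0; have [F [dF Foo F0]] := powM_expR_primitive m c0.
have cf : continuous (fun t : R => t ^+ m * expR (- (c * t))).
  move=> t; apply: cvgM; first exact: exprn_continuous.
  by have [/derivable1_diffP/differentiable_continuous] := is_derive_expRNM c t.
rewrite integral_itv_obnd_cbnd; last first.
  apply/measurable_EFinP; apply: measurable_funTS.
  exact: (continuous_measurable_fun cf).
rewrite (ge0_continuous_FTC2y _ _ Foo).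
- by rewrite F0 -EFinB opprK add0r.
- by move=> t t0; rewrite mulr_ge0 ?exprn_ge0 ?expR_ge0.
- exact: continuous_subspaceT.
- by move=> t _; have [] := dF t.
- apply: cvg_at_right_filter.
  by have [/derivable1_diffP/differentiable_continuous] := dF 0.
- by move=> t _; rewrite derive1E; have [_ ->] := dF t.
Qed.

Lemma integrable_powM_expR (R : realType) (m : nat) (c : R) : 0 < c ->
  (@lebesgue_measure R).-integrable `]0%R, +oo[
    (fun t => (t ^+ m * expR (- (c * t)))%:E).
Proof.
move=> c0; apply/integrableP; split.
  apply/measurable_EFinP; apply: measurable_funM; first exact: measurable_funX.
  apply: measurable_funTS; apply: measurableT_comp => //.
  by apply: measurableT_comp => //; exact: measurable_funM.
rewrite [ltLHS](_ : _ = (m`!%:R / c ^+ m.+1)%:E) ?ltry//.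
rewrite -integral_powM_expR//; apply: eq_integral.
move=> t; rewrite inE/= in_itv/= andbT => t0.
by rewrite /= ger0_norm// mulr_ge0 ?expR_ge0 ?exprn_ge0 1?ltW.
Qed.

Lemma integral_powM_expR_onem (R : realType) (N m : nat) (a : R) : 0 < a ->
  (\int[lebesgue_measure]_(t in `]0%R, +oo[)
     (t ^+ m * expR (- (a * t)) * (1 - expR (- t)) ^+ N)%:E
   = (m`!%:R * alt_bin_sum N m a)%:E)%E.
Proof.
move=> a0; have ai (i : nat) : 0 < a + i%:R by rewrite ltr_wpDr.
pose f i t : R := t ^+ m * expR (- ((a + i%:R) * t)).
transitivity (\int[lebesgue_measure]_(t in `]0%R, +oo[)
  (\sum_(i < N.+1) ((-1) ^+ i * 'C(N, i)%:R)%:E * (f i t)%:E))%E.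
  apply: eq_integral => t _; under eq_bigr do rewrite -EFinM.
  rewrite sumEFin; congr (_%:E).
  rewrite exprDn mulr_sumr; apply: eq_bigr => i _.
  rewrite expr1n mul1r [(- expR _) ^+ i]exprNn -expRM_natr -[_ *+ _]mulr_natr /f.
  have -> : - ((a + i%:R) * t) = - (a * t) + - t * i%:R by ring.
  by rewrite expRD; ring.
have intf (i : 'I_N.+1) : (@lebesgue_measure R).-integrable `]0%R, +oo[
    (fun t => ((-1) ^+ i * 'C(N, i)%:R)%:E * (f i t)%:E)%E.
  by apply: integrableZl => //; exact: integrable_powM_expR.
etransitivity; first exact: (integral_sum _ intf).
rewrite /alt_bin_sum mulr_sumr -sumEFin; apply: eq_bigr => i _.
rewrite integralZl//; last exact: integrable_powM_expR.
by rewrite integral_powM_expR// -EFinM mulrCA.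
Qed.

(** For [c < 1] the integrand is unbounded near [1], so the fundamental theorem
    of calculus is applied on [[0, b i]] with [b i] increasing to [1]. *)
Lemma integral_powR_onem (R : realType) (c : R) : 0 < c ->
  (\int[lebesgue_measure]_(t in `]0%R, 1%R[) ((1 - t) `^ (c - 1))%:E
   = (c^-1)%:E)%E.
Proof.
move=> c0; pose f t : R := (1 - t) `^ (c - 1).
have dF (t : R) : t < 1 -> is_derive t 1 (fun t => - (c^-1 * (1 - t) `^ c)) (f t).
  move=> t1; have h : is_derive t 1 (fun t => 1 - t) (-1).
    by apply: is_derive_eq; rewrite add0r mul1r.
  have t0 : 0 < 1 - t by rewrite subr_gt0.
  have := is_derive1_comp (f := fun x => x `^ c) (g := fun t => 1 - t)
    (is_derive1_powR c t0) h.
  move=> h'; have {}h' : is_derive t 1 (fun t => (1 - t) `^ c) _ := h'.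
  apply: is_derive_eq; rewrite /GRing.scale/= /f; field.
  by rewrite gt_eqF.
have cf (t : R) : t < 1 -> f u @[u --> t] --> f t.
  move=> t1; have t0 : 0 < 1 - t by rewrite subr_gt0.
  apply: (@cvg_comp _ _ _ (fun u => 1 - u) (fun u => u `^ (c - 1)) _
    (nbhs (1 - t))); first by apply: cvgB; [exact: cvg_cst|exact: cvg_id].
  by have [/derivable1_diffP/differentiable_continuous] :=
    is_derive1_powR (c - 1) t0.
have mf : measurable_fun setT f.
  apply: (@measurableT_comp _ _ _ _ _ _ (fun u => u `^ (c - 1))) => //.
  exact: measurable_funB.
(* With this choice [1 - b i] to the power [c] is again an exponential. *)
pose b i : R := 1 - expR (- i.+1%:R).
have b1 i : b i < 1 by rewrite ltrBlDr ltrDl expR_gt0.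
have b0 i : 0 < b i by apply: onem_expRN_gt0.
rewrite integral_itv_obnd_cbnd; last exact/measurable_EFinP/measurable_funTS.
have -> : `[0%R, 1%R[%classic = \bigcup_i `[0, b i]%classic.
  apply/seteqP; split => [t/=|t [i _]/=]; rewrite !in_itv/=; last first.
    by move=> /andP[-> tb]/=; exact: le_lt_trans tb _.
  move=> /andP[t0 t1]; exists (Num.truncn (- ln (1 - t))) => //=.
  rewrite in_itv/= t0/= /b lerBrDr -lerBrDl.
  rewrite -[leRHS]lnK ?posrE ?subr_gt0// ler_expR lerNl.
  by rewrite ltW// truncnS_gt.
have nd : nondecreasing_seq (fun i => `[0, b i]%classic).
  move=> i j ij; apply/subsetPset => t/=; rewrite !in_itv/= => /andP[-> tb]/=.
  by apply: le_trans tb _; rewrite lerD2l lerN2 ler_expR lerN2 ler_nat.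
have h : (\int[lebesgue_measure]_(t in `[0%R, b i]) (f t)%:E @[i --> \oo] -->
    \int[lebesgue_measure]_(t in \bigcup_i `[0%R, b i]%classic) (f t)%:E)%E.
  apply: ge0_nondecreasing_set_cvg_integral => //.
  - by move=> i; exact/measurable_EFinP/measurable_funTS.
  - by move=> i t _; rewrite lee_fin powR_ge0.
apply: (cvg_unique _ h) => //.
rewrite (_ : (fun i => _) =
  (fun i => (c^-1 - c^-1 * (expR (- i.+1%:R)) `^ c)%:E)); last first.
  apply/funext => i; rewrite (@continuous_FTC2 _ f (fun t => - (c^-1 * (1 - t) `^ c)))//.
  - rewrite -EFinB; congr (_%:E); rewrite subr0 powR1 mulr1 opprK addrC.
    by rewrite /b opprB addrCA subrr addr0.
  - apply/continuous_within_itvP => //; split.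
    + by move=> t; rewrite in_itv/= => /andP[_ tb]; apply/cf/(lt_trans tb).
    + by apply: cvg_at_right_filter; apply: cf.
    + by apply: cvg_at_left_filter; apply: cf.
  - split.
    + move=> t; rewrite in_itv/= => /andP[_ tb].
      by have [] := dF t (lt_trans tb (b1 i)).
    + apply: cvg_at_right_filter.
      by have [/derivable1_diffP/differentiable_continuous] := dF 0 ltr01.
    + apply: cvg_at_left_filter.
      by have [/derivable1_diffP/differentiable_continuous] := dF (b i) (b1 i).
  - move=> t; rewrite in_itv/= => /andP[_ tb]; rewrite derive1E.
    by have [_ ->] := dF t (lt_trans tb (b1 i)).
apply: cvg_EFin; first exact: nearW.
rewrite -[X in _ --> X]subr0 -(mulr0 c^-1).
apply: cvgB; first exact: cvg_cst.
apply: cvgMl_tmp; rewrite (_ : (fun i => _) =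
  (fun t => t ^+ 0 * expR (- (c * t))) \o (fun i : nat => i.+1%:R)); last first.
  by apply/funext => i/=; rewrite expr0 mul1r -expRM mulNr mulrC.
apply: (@cvg_comp _ _ _ (fun i : nat => i.+1%:R)
  (fun t => t ^+ 0 * expR (- (c * t))) _ (pinfty_nbhs R)); last exact: cvgy_powM_expR.
by rewrite (cvg_shiftS (fun i : nat => i%:R : R)); exact: cvgr_idn.
Qed.

Lemma euler_betaE (R : realType) (N : nat) (a : R) : 0 < a ->
  euler_beta N.+1%:R a = alt_bin_sum N 0 a.
Proof.
move=> a0; have ai (i : nat) : 0 < a + i%:R by rewrite ltr_wpDr.
pose f i t : R := (1 - t) `^ (a + i%:R - 1).
have intf0 (i : nat) : (@lebesgue_measure R).-integrable `]0%R, 1%R[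
    (fun t => (f i t)%:E).
  apply/integrableP; split.
    apply/measurable_EFinP/measurable_funTS.
    apply: (@measurableT_comp _ _ _ _ _ _ (fun u => u `^ (a + i%:R - 1))) => //.
    exact: measurable_funB.
  rewrite [ltLHS](_ : _ = (a + i%:R)^-1%:E) ?ltry//.
  rewrite -integral_powR_onem//; apply: eq_integral => t _.
  by rewrite /= ger0_norm ?powR_ge0.
have intf (i : 'I_N.+1) : (@lebesgue_measure R).-integrable `]0%R, 1%R[
    (fun t => ((-1) ^+ i * 'C(N, i)%:R)%:E * (f i t)%:E)%E.
  exact: integrableZl.
rewrite /euler_beta /Rintegral; rewrite -[RHS]/(fine (_%:E)); congr fine.
(* Expand [t ^ N = (1 - (1 - t)) ^ N]. *)
transitivity (\int[lebesgue_measure]_(t in `]0%R, 1%R[)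
  (\sum_(i < N.+1) ((-1) ^+ i * 'C(N, i)%:R)%:E * (f i t)%:E))%E.
  apply: eq_integral => t; rewrite inE/= in_itv/= => /andP[t0 t1].
  under eq_bigr do rewrite -EFinM.
  rewrite sumEFin; congr (_%:E).
  have -> : N.+1%:R - 1 = N%:R :> R by rewrite -natr1 addrK.
  have u0 : 0 < 1 - t by rewrite subr_gt0.
  rewrite powR_mulrn ?ltW// -{1}(subKr 1 t) exprDn mulr_suml.
  apply: eq_bigr => i _.
  rewrite expr1n mul1r [(- (_ - _)) ^+ i]exprNn -[_ *+ _]mulr_natr /f.
  have -> : a + i%:R - 1 = i%:R + (a - 1) by ring.
  rewrite [X in _ = _ * X]powRD; last by rewrite (gt_eqF u0) implybT.
  by rewrite powR_mulrn ?ltW//; ring.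
etransitivity; first exact: (integral_sum _ intf).
rewrite /alt_bin_sum -sumEFin; apply: eq_bigr => i _.
rewrite integralZl//.
by rewrite integral_powR_onem// -EFinM expr1.
Qed.

(** * Sums over increasing tuples *)

(** The sum is a partial sum of [- ln (1 - z) = t], where [z = 1 - exp (- t)]; the
    derivative of the left-hand side telescopes to [1 - z ^ N <= 1]. *)
Lemma log_series_le (R : realType) (N : nat) (t : R) : 0 <= t ->
  \sum_(j < N) (1 - expR (- t)) ^+ j.+1 / j.+1%:R <= t.
Proof.
pose S (u : R) : R := \sum_(j < N) (1 - expR (- u)) ^+ j.+1 / j.+1%:R.
have dS (u : R) : is_derive u 1 S (1 - (1 - expR (- u)) ^+ N).
  rewrite /S; elim: N {S} => [|N IH].
    rewrite expr0 subrr (_ : (fun _ => _) = cst 0); first exact: is_derive_cst.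
    by apply/funext => w; rewrite big_ord0.
  rewrite (_ : (fun _ => _) = (fun u : R =>
    (\sum_(j < N) (1 - expR (- u)) ^+ j.+1 / j.+1%:R) +
    N.+1%:R^-1 * (1 - expR (- u)) ^+ N.+1)); last first.
    by apply/funext => w; rewrite big_ord_recr/= mulrC.
  have dz : is_derive u 1 (fun u => 1 - expR (- u)) (expR (- u)).
    have := is_derive_expRNM 1 u; rewrite !mul1r.
    rewrite (_ : (fun t0 => _) = (fun t => expR (- t))); last first.
      by apply/funext => w; rewrite mul1r.
    move=> h; have := is_deriveB (is_derive_cst (1 : R) u 1) h.
    by move=> /is_derive_eq; apply; rewrite sub0r opprK.
  have dm := @is_deriveX _ _ _ N.+1 _ _ _ dz.
  have {}dm : is_derive u 1 (fun t => (1 - expR (- t)) ^+ N.+1)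
      (N.+1%:R * (1 - expR (- u)) ^+ N * expR (- u)).
    rewrite (_ : (fun t => _) = (fun u => 1 - expR (- u)) ^+ N.+1); last first.
      by apply/funext => w; rewrite exprfctE.
    by apply: is_derive_eq dm _; rewrite /GRing.scale/=.
  apply: is_derive_eq; rewrite /GRing.scale/= exprS; field.
  by rewrite nat1r pnatr_eq0.
rewrite le_eqVlt => /predU1P[<-|t0].
  by rewrite big1// => j _; rewrite oppr0 expR0 subrr expr0n mul0r.
pose h u := u - S u.
have dh (u : R) : is_derive u 1 h ((1 - expR (- u)) ^+ N).
  by apply: is_derive_eq; rewrite subKr.
have S0 : S 0 = 0.
  by rewrite /S big1// => j _; rewrite oppr0 expR0 subrr expr0n mul0r.
suff : h 0 <= h t by rewrite /h S0 subrr subr_ge0.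
apply: (@ger0_derive1_le_cc _ h 0 t) => //; rewrite ?in_itv/= ?lexx ?ltW//.
- move=> u; rewrite in_itv/= => /andP[u0 _]; rewrite derive1E.
  by have [_ ->] := dh u; rewrite exprn_ge0// onem_expRN_ge0// ltW.
- apply: continuous_subspaceT => u.
  by have [/derivable1_diffP/differentiable_continuous] := dh u.
Qed.

(** The first entry is [n0 + j + 1], indexed by the gap [j + 1]; the remaining
    ones increase from it. *)
Lemma esum_increasing_tupleS (R : realType) (k n0 : nat)
    (f : k.+1.-tuple nat -> \bar R) : (forall n, 0 <= f n)%E ->
  (\esum_(n in [set n : k.+1.-tuple nat | path ltn n0 n]) f n =
   \esum_(j in [set: nat])
     \esum_(n in [set n : k.-tuple nat | path ltn (n0 + j).+1 n])
       f [tuple of (n0 + j).+1 :: n])%E.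
Proof.
move=> f0; rewrite esum_esum//.
apply: (@reindex_esum _ _ _
  ([set: nat] `*`` (fun j => [set n : k.-tuple nat | path ltn (n0 + j).+1 n])) _
  (fun q : nat * k.-tuple nat => [tuple of (n0 + q.1).+1 :: q.2])).
split.
- by move=> [j n] [_ /= pn]/=; rewrite pn andbT; lia.
- move=> [j n] [j' n'] _ _ /(congr1 val)/= [jj' nn'].
  by congr (_, _); [lia|exact: val_inj].
- move=> n /=; case/tupleP: n => i n /= /andP[n0i pn].
  have e : (n0 + (i - n0.+1)).+1 = i by rewrite -addSn subnKC.
  exists ((i - n0.+1)%N, n); first by split; rewrite //= e.
  by apply: val_inj; rewrite /= e.
Qed.

Lemma tuple_weight_ge0 (R : realType) (k : nat) (v n : k.-tuple nat) :
  0 <= tuple_weight v n :> R.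
Proof. by apply: prodr_ge0 => i _; exact: exprn_ge0. Qed.

Lemma tuple_weight_cons (R : realType) (k : nat) (v : k.+1.-tuple nat) (i : nat)
    (n : k.-tuple nat) :
  tuple_weight v [tuple of i :: n] =
  i%:R ^+ thead v * tuple_weight (behead_tuple v) n :> R.
Proof.
rewrite /tuple_weight big_ord_recl; congr (_ * _); apply: eq_bigr => j _.
by rewrite !(tnth_nth 0%N)/= nth_behead.
Qed.

Lemma esumZl (R : realType) (T : choiceType) (D : set T) (r : R)
    (f : T -> \bar R) : 0 <= r -> (forall i, 0 <= f i)%E ->
  (\esum_(i in D) (r%:E * f i) = r%:E * \esum_(i in D) f i)%E.
Proof.
move=> r0 f0; rewrite /esum -ereal_supZl//; last first.
  by apply/set0P; eexists; exists set0; [exact: fsets_set0|reflexivity].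
rewrite image_comp; congr ereal_sup; apply: eq_imagel => A _.
by rewrite /= ge0_mule_fsumr.
Qed.

(** Let [z = 1 - exp (- t)]. By induction on [k]: for the first entry
    [i = n0 + j + 1], the sum over the other ones is at most [z ^ i t ^ (k - 1)],
    and [sum_j z ^ (n0 + j + 1) / (n0 + j + 1)] is at most
    [z ^ n0 sum_j z ^ (j + 1) / (j + 1) <= z ^ n0 t]. *)
Lemma esum_increasing_tuples_le (R : realType) (k n0 : nat) (v : k.-tuple nat)
    (t : R) : (forall i, 0 < tnth v i)%N -> 0 <= t ->
  (\esum_(n in [set n : k.-tuple nat | path ltn n0 n])
     ((1 - expR (- t)) ^+ last n0 n / tuple_weight v n)%:E <=
   ((1 - expR (- t)) ^+ n0 * t ^+ k)%:E)%E.
Proof.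
move=> + t0; set z := 1 - expR (- t).
have z0 : 0 <= z by exact: onem_expRN_ge0.
have w0 j (w n : j.-tuple nat) : 0 <= tuple_weight w n :> R.
  exact: tuple_weight_ge0.
elim: k n0 v => [|k IH] n0 v v0.
  rewrite (_ : [set n | _] = [set [tuple]]); last first.
    by apply/seteqP; split => n /=; rewrite tuple0.
  by rewrite esum_set1/= /tuple_weight big_ord0 ?divr1 ?mulr1// lee_fin exprn_ge0.
rewrite esum_increasing_tupleS; last first.
  by move=> n; rewrite lee_fin divr_ge0// exprn_ge0.
apply: (@le_trans _ _ (\esum_(j in [set: nat])
  (z ^+ n0 * t ^+ k * (z ^+ j.+1 / j.+1%:R))%:E)%E); last first.
  rewrite -nneseries_esumT; last first.
    by move=> j; rewrite lee_fin !mulr_ge0 ?exprn_ge0 ?invr_ge0.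
  apply: lime_le.
    apply: is_cvg_nneseries => j _ _.
    by rewrite lee_fin !mulr_ge0 ?exprn_ge0 ?invr_ge0.
  apply: nearW => N; rewrite sumEFin lee_fin -mulr_sumr exprSr mulrA big_mkord.
  by rewrite ler_wpM2l ?mulr_ge0 ?exprn_ge0// log_series_le.
apply: le_esum => j _; set i := (n0 + j).+1.
have i0 : 0 < i%:R :> R by rewrite ltr0n.
have v'0 l : (0 < tnth (behead_tuple v) l)%N.
  by rewrite (tnth_nth 0%N)/= nth_behead -(tnth_nth 0%N _ (lift ord0 l)).
(* Replacing the denominator [i] by the gap [j + 1] costs a factor at most 1. *)
have ei : i%:R^-1 * (z ^+ i * t ^+ k) =
    z ^+ n0 * t ^+ k * (z ^+ j.+1 / j.+1%:R) * (j.+1%:R / i%:R).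
  have j0 : j.+1%:R != 0 :> R by rewrite pnatr_eq0.
  have ii0 : i%:R != 0 :> R by rewrite gt_eqF.
  have -> : z ^+ i = z ^+ n0 * z ^+ j.+1 by rewrite /i -addnS exprD.
  by field; rewrite nat1r j0 ii0.
apply: (@le_trans _ _ ((i%:R^-1)%:E * (z ^+ i * t ^+ k)%:E)%E); last first.
  rewrite -EFinM lee_fin ei ler_piMr//.
    by rewrite !mulr_ge0 ?exprn_ge0 ?invr_ge0.
  by rewrite ler_pdivrMr// mul1r ler_nat ltnS leq_addl.
apply: (@le_trans _ _ (\esum_(n in [set n : k.-tuple nat | path ltn i n])
    ((i%:R^-1)%:E * (z ^+ last i n / tuple_weight (behead_tuple v) n)%:E))%E).
  apply: le_esum => n _; rewrite -EFinM lee_fin tuple_weight_cons /= invfM mulrCA.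
  rewrite ler_wpM2r ?divr_ge0 ?exprn_ge0// lef_pV2 ?posrE ?exprn_gt0//.
  by rewrite ler_eXnr ?ler1n//; exact: (v0 ord0).
rewrite esumZl ?invr_ge0// => [|n]; last by rewrite lee_fin divr_ge0 ?exprn_ge0.
by rewrite lee_wpmul2l ?lee_fin ?invr_ge0// IH.
Qed.

(** * Exchanging integrals and unordered sums *)

(** A family on a countable type as a sequence, extended by [0]: this transfers
    results on series to [esum]. *)
Definition pickle_extend (R : realType) (T : countType) (D : set T)
    (f : T -> \bar R) (n : nat) : \bar R :=
  if pickle_inv n is Some i then (if i \in D then f i else 0%E) else 0%E.

Lemma pickle_extend_ge0 (R : realType) (T : countType) (D : set T)
    (f : T -> \bar R) (n : nat) :
  (forall i, D i -> 0 <= f i)%E -> (0 <= pickle_extend D f n)%E.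
Proof.
move=> f0; rewrite /pickle_extend; case: pickle_inv => // i.
by case: ifPn => //; rewrite inE => /f0.
Qed.

Lemma esum_pickle_extend (R : realType) (T : countType) (D : set T)
    (f : T -> \bar R) : (forall i, D i -> 0 <= f i)%E ->
  (\esum_(i in D) f i = \sum_(n <oo) pickle_extend D f n)%E.
Proof.
move=> f0; rewrite nneseries_esumT; last by move=> n; exact: pickle_extend_ge0.
transitivity (\esum_(n in pickle @` D) pickle_extend D f n)%E.
  rewrite (esum_image D pickle); last first.
    by move=> i j _ _; exact: (pcan_inj pickleK).
  by apply: eq_esum => i Di; rewrite /pickle_extend pickleK_inv mem_set.
rewrite esum_mkcond; apply: eq_esum => n _; case: ifPn => // nD.
rewrite /pickle_extend; case E : pickle_inv => [i|//]; case: ifPn => // iD.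
move: nD; rewrite notin_setE => -[]; exists i; first by rewrite inE in iD.
by have := @pickle_invK T n; rewrite E.
Qed.

Lemma measurable_pickle_extend (d : measure_display) (X : measurableType d)
    (R : realType) (E : set X) (T : countType) (D : set T)
    (f : T -> X -> \bar R) (n : nat) :
  (forall i, D i -> measurable_fun E (f i)) ->
  measurable_fun E (fun x => pickle_extend D (f ^~ x) n).
Proof.
move=> mf; rewrite /pickle_extend.
case: pickle_inv => [i|]; last exact: measurable_cst.
by have [/set_mem/mf|_] := boolP (i \in D); [|exact: measurable_cst].
Qed.

Lemma measurable_esum (d : measure_display) (X : measurableType d)
    (R : realType) (E : set X) (T : countType) (D : set T)
    (f : T -> X -> \bar R) :
  (forall i, D i -> measurable_fun E (f i)) ->
  (forall i x, D i -> E x -> 0 <= f i x)%E ->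
  measurable_fun E (fun x => \esum_(i in D) f i x)%E.
Proof.
move=> mf f0; apply: (@eq_measurable_fun _ _ _ _ _
    (fun x => \sum_(n <oo | n \in xpredT) pickle_extend D (f ^~ x) n)%E).
  by move=> x; rewrite inE => Ex; rewrite esum_pickle_extend// => i Di; exact: f0.
apply: ge0_emeasurable_sum => [n x Ex _|n _]; last exact: measurable_pickle_extend.
by apply: pickle_extend_ge0 => i Di; exact: f0.
Qed.

(** Tonelli's theorem for a countable family, reduced to the case of series. *)
Lemma integral_esum (d : measure_display) (X : measurableType d)
    (R : realType) (mu : {measure set X -> \bar R}) (E : set X)
    (T : countType) (D : set T) (f : T -> X -> \bar R) :
  measurable E -> (forall i, D i -> measurable_fun E (f i)) ->
  (forall i x, D i -> E x -> 0 <= f i x)%E ->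
  (\int[mu]_(x in E) (\esum_(i in D) f i x) =
   \esum_(i in D) \int[mu]_(x in E) f i x)%E.
Proof.
move=> mE mf f0; rewrite esum_pickle_extend; last first.
  by move=> i Di; apply: integral_ge0 => x Ex; exact: f0.
transitivity (\int[mu]_(x in E) (\sum_(n <oo) pickle_extend D (f ^~ x) n))%E.
  apply: eq_integral => x; rewrite inE => Ex.
  by rewrite esum_pickle_extend// => i Di; exact: f0.
rewrite integral_nneseries//; last 2 first.
- by move=> n; exact: measurable_pickle_extend.
- by move=> n x Ex; apply: pickle_extend_ge0 => i Di; exact: f0.
apply: eq_eseriesr => n _; rewrite /pickle_extend.
case: pickle_inv => [i|]; last exact: integral0.
by have [//|_] := boolP (i \in D); exact: integral0.
Qed.

Lemma ge0_rsum (R : realType) (T : choiceType) (D : set T) (f : T -> R) :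
  (forall i, D i -> 0 <= f i) ->
  rsum D f = fine (\esum_(i in D) (f i)%:E)%E.
Proof.
move=> f0; rewrite /rsum; congr fine.
have e0 i : D i -> (0 <= (EFin \o f) i)%E by move=> Di; rewrite lee_fin f0.
rewrite (eq_esum (b := EFin \o f)); last first.
  by move=> i Di; rewrite (ge0_funeposE e0)// inE.
rewrite [X in (_ - X)%E]esum1 ?sube0// => i Di.
by rewrite (ge0_funenegE e0)// inE.
Qed.

(** * Complex powers and the gamma function at positive integers *)

Lemma cpow_natr (R : realType) (t : R) (m : nat) : 0 < t ->
  cpow t m%:R = (t ^+ m)%:C.
Proof.
move=> t0; rewrite -(rmorph_nat (real_complex R)) /cpow /=.
rewrite mul0r cos0 sin0 mulr1 mulr0.
by rewrite -powR_mulrn ?ltW// /powR gt_eqF.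
Qed.

Lemma cintegral_real (R : realType) (D : set R) (f : R -> R[i]) (g : R -> R) :
  (forall t, D t -> f t = (g t)%:C) ->
  cintegral D f = (\int[lebesgue_measure]_(t in D) g t)%:C.
Proof.
move=> fg; rewrite /cintegral /Rintegral; congr (_ +i* _).
  by congr fine; apply: eq_integral => t; rewrite inE => /fg ->.
by rewrite integral0_eq// => t /fg ->.
Qed.

Lemma gammaS_natr (R : realType) (m : nat) :
  gamma (m.+1%:R : R[i]) = (m`!%:R : R)%:C.
Proof.
have mE : m.+1%:R = (m.+1%:R : R)%:C by rewrite -(rmorph_nat (real_complex R)).
rewrite /gamma mE /= (_ : Num.truncn _ = 0%N); last first.
  apply/eqP; rewrite -leqn0 truncn_le_nat -[m.+1]add1n natrD.
  by have := ler0n R m; lra.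
rewrite big_ord0 divr1 addr0 -mE /gamma_integral -natr1 addrK.
(* The factor 1 makes this an instance of [integral_powM_expR]. *)
rewrite (@cintegral_real _ _ _ (fun t => t ^+ m * expR (- (1 * t)))); last first.
  move=> t /=; rewrite in_itv/= andbT => t0.
  by rewrite cpow_natr// -rmorphM/= mul1r mulrC.
by rewrite /Rintegral integral_powM_expR// expr1n divr1.
Qed.

(** * The series under the integral *)

Lemma increasing_tuples_last_gt0 (k : nat) (n : k.-tuple nat) :
  (0 < k)%N -> increasing_tuples n -> (0 < last 0 n)%N.
Proof.
case: k n => // k n _; case/tupleP: n => i n /= /andP[i0].
elim: (val n) i i0 => //= j s IH i i0 /andP[ij].
by apply: IH; exact: ltn_trans ij.
Qed.

Lemma mzeta_kernelE (R : realType) (x t : R) : 0 < t ->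
  expR (- (x * t)) / (expR t - 1) = expR (- ((1 + x) * t)) / (1 - expR (- t)).
Proof.
move=> t0; have e1 : expR t - 1 != 0 by rewrite subr_eq0 gt_eqF// -expR0 ltr_expR.
have -> : - ((1 + x) * t) = - (x * t) - t by ring.
have e0 : expR t != 0 by rewrite gt_eqF ?expR_gt0.
by rewrite expRD [expR (- t)]expRN; field; rewrite e0 e1.
Qed.

(** The contribution of [n] to the integrand, with one factor [1 - exp (- t)]
    cancelled against the kernel so that no singularity at [t = 0] remains. *)
Definition mzeta_term (R : realType) (k : nat) (v : k.-tuple nat) (m : nat)
    (p x : R) (n : k.-tuple nat) (t : R) : R :=
  (p ^+ last 0%N n * tuple_weight v n)^-1 *
  (t ^+ m * expR (- ((1 + x) * t)) * (1 - expR (- t)) ^+ (last 0%N n).-1).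

Lemma mzeta_term_ge0 (R : realType) (k : nat) (v : k.-tuple nat) (m : nat)
    (p x t : R) (n : k.-tuple nat) : 0 <= p -> 0 <= t -> 0 <= mzeta_term v m p x n t.
Proof.
move=> p0 t0; rewrite /mzeta_term !mulr_ge0 ?invr_ge0 ?expR_ge0 ?exprn_ge0//.
- by rewrite mulr_ge0 ?exprn_ge0 ?tuple_weight_ge0.
- exact: onem_expRN_ge0.
Qed.

Lemma mzeta_termE (R : realType) (k : nat) (v : k.-tuple nat) (m : nat)
    (p x t : R) (n : k.-tuple nat) : (0 < k)%N -> 0 < t -> increasing_tuples n ->
  mzeta_term v m p x n t = expR (- (x * t)) / (expR t - 1) * t ^+ m *
    (((1 - expR (- t)) / p) ^+ last 0%N n / tuple_weight v n).
Proof.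
move=> k0 t0 /(increasing_tuples_last_gt0 k0) l0.
have z0 : 1 - expR (- t) != 0 by rewrite gt_eqF// onem_expRN_gt0.
rewrite mzeta_kernelE// /mzeta_term -[in RHS](prednK l0) expr_div_n.
rewrite [(1 - expR (- t)) ^+ _.+1]exprS prednK// invfM.
set z := 1 - _; rewrite [RHS](_ : _ =
  (z^-1 * z) * ((p ^+ last 0%N n)^-1 / tuple_weight v n *
    (t ^+ m * expR (- ((1 + x) * t)) * z ^+ (last 0%N n).-1))); last by ring.
by rewrite mulVf// mul1r.
Qed.

Lemma measurable_powM_expR_onem (R : realType) (N m : nat) (a : R) (D : set R) :
  measurable_fun D
    (fun t : R => t ^+ m * expR (- (a * t)) * (1 - expR (- t)) ^+ N).
Proof.
apply: measurable_funTS; apply: measurable_funM.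
  apply: measurable_funM; first exact: measurable_funX.
  apply: measurableT_comp => //.
  by apply: measurableT_comp => //; exact: measurable_funM.
apply: measurable_funX; apply: measurable_funB => //.
exact: measurableT_comp.
Qed.

Lemma measurable_mzeta_term (R : realType) (k : nat) (v : k.-tuple nat)
    (m : nat) (p x : R) (n : k.-tuple nat) (D : set R) :
  measurable_fun D (mzeta_term v m p x n).
Proof. by apply: measurable_funM => //; exact: measurable_powM_expR_onem. Qed.

Lemma integral_mzeta_term (R : realType) (k : nat) (v : k.-tuple nat)
    (m : nat) (p x : R) (n : k.-tuple nat) :
  (0 < k)%N -> 0 <= p -> 0 < 1 + x -> increasing_tuples n ->
  (\int[lebesgue_measure]_(t in `]0%R, +oo[) (mzeta_term v m p x n t)%:E =
   (m`!%:R * (euler_beta (last 0%N n)%:R (1 + x) *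
      modified_bell m (fun s => harmonic_shift (last 0%N n) s x) /
      (p ^+ last 0%N n * tuple_weight v n)))%:E)%E.
Proof.
move=> k0 p0 a0 /(increasing_tuples_last_gt0 k0) l0.
rewrite /mzeta_term; case: (last 0%N n) l0 => // N _ /=.
under eq_integral do rewrite EFinM.
rewrite ge0_integralZl_EFin//.
- rewrite integral_powM_expR_onem// -EFinM euler_betaE// alt_bin_sum_bell//.
  by congr (_%:E); rewrite [LHS]mulrC !mulrA.
- move=> t; rewrite /= in_itv/= andbT => t0.
  have z0 : 0 <= 1 - expR (- t) by rewrite onem_expRN_ge0// ltW.
  by rewrite lee_fin !mulr_ge0 ?expR_ge0 ?exprn_ge0// ltW.
- apply/measurable_EFinP; exact: measurable_powM_expR_onem.
- by rewrite invr_ge0 mulr_ge0 ?exprn_ge0 ?tuple_weight_ge0.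
Qed.

Lemma polylog_series_le (R : realType) (k : nat) (v : k.-tuple nat) (p t : R) :
  (forall i, 0 < tnth v i)%N -> 1 <= p -> 0 <= t ->
  (\esum_(n in @increasing_tuples k)
    (((1 - expR (- t)) / p) ^+ last 0%N n / tuple_weight v n)%:E <=
   (t ^+ k)%:E)%E.
Proof.
move=> v0 p1 t0; have p0 : 0 < p by exact: lt_le_trans p1.
have z0 : 0 <= 1 - expR (- t) by exact: onem_expRN_ge0.
rewrite -[t ^+ k]mul1r -(expr0 (1 - expR (- t))).
apply: le_trans (esum_increasing_tuples_le 0 v0 t0).
apply: le_esum => n _; rewrite lee_fin ler_wpM2r ?invr_ge0 ?tuple_weight_ge0//.
by rewrite lerXn2r ?nnegrE ?divr_ge0 ?(ltW p0)// ler_pdivrMr// ler_peMr.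
Qed.

Lemma EFin_polylog (R : realType) (k : nat) (v : k.-tuple nat) (p t : R) :
  (forall i, 0 < tnth v i)%N -> 1 <= p -> 0 <= t ->
  (polylog v ((1 - expR (- t)) / p))%:E =
  (\esum_(n in @increasing_tuples k)
    (((1 - expR (- t)) / p) ^+ last 0%N n / tuple_weight v n)%:E)%E.
Proof.
move=> v0 p1 t0; have p0 : 0 < p by exact: lt_le_trans p1.
have z0 : 0 <= 1 - expR (- t) by exact: onem_expRN_ge0.
have f0 (n : k.-tuple nat) :
    0 <= ((1 - expR (- t)) / p) ^+ last 0%N n / tuple_weight v n.
  by rewrite mulr_ge0 ?invr_ge0 ?tuple_weight_ge0// exprn_ge0// divr_ge0// ltW.
rewrite /polylog ge0_rsum// fineK// ge0_fin_numE; last first.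
  by apply: esum_ge0 => n _; rewrite lee_fin.
by apply: le_lt_trans (ltry (t ^+ k)); exact: polylog_series_le.
Qed.

Lemma esum_mzeta_term (R : realType) (k : nat) (v : k.-tuple nat) (m : nat)
    (p x t : R) :
  (0 < k)%N -> (forall i, 0 < tnth v i)%N -> 1 <= p -> 0 < t ->
  (\esum_(n in @increasing_tuples k) (mzeta_term v m p x n t)%:E =
   (expR (- (x * t)) / (expR t - 1) * t ^+ m *
     polylog v ((1 - expR (- t)) / p))%:E)%E.
Proof.
move=> k0 v0 p1 t0; have p0 : 0 < p by exact: lt_le_trans p1.
have z0 : 0 <= 1 - expR (- t) by rewrite onem_expRN_ge0// ltW.
rewrite EFinM EFin_polylog// ?ltW// -esumZl.
- by apply: eq_esum => n Dn; rewrite -EFinM mzeta_termE.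
- rewrite mulr_ge0 ?exprn_ge0 ?(ltW t0)// divr_ge0 ?expR_ge0// subr_ge0.
  by rewrite -expR0 ler_expR ltW.
- move=> n; rewrite lee_fin mulr_ge0 ?invr_ge0 ?tuple_weight_ge0//.
  by rewrite exprn_ge0// divr_ge0// ltW.
Qed.

(** One factor [t] of the bound [t ^ (k + 1)] on the polylogarithm compensates the
    pole of the kernel: [t / (1 - exp (- t)) <= 1 + t]. *)
Lemma esum_mzeta_term_le (R : realType) (k : nat) (v : k.+1.-tuple nat) (m : nat)
    (p x t : R) :
  (forall i, 0 < tnth v i)%N -> 1 <= p -> 0 < t ->
  (\esum_(n in @increasing_tuples k.+1) (mzeta_term v m p x n t)%:E <=
   (t ^+ (m + k) * expR (- ((1 + x) * t)) +
    t ^+ (m + k).+1 * expR (- ((1 + x) * t)))%:E)%E.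
Proof.
move=> v0 p1 t0; rewrite esum_mzeta_term// lee_fin mzeta_kernelE//.
have z0 : 0 < 1 - expR (- t) by exact: onem_expRN_gt0.
have zt : t / (1 - expR (- t)) <= 1 + t.
  have h : (1 + t) * expR (- t) <= 1.
    by rewrite expRN ler_pdivrMr ?expR_gt0// mul1r expR_ge1Dx.
  by rewrite ler_pdivrMr// mulrBr mulr1; lra.
have Lt : polylog v ((1 - expR (- t)) / p) <= t ^+ k.+1.
  by rewrite -lee_fin EFin_polylog ?polylog_series_le// ltW.
apply: (@le_trans _ _
    (expR (- ((1 + x) * t)) / (1 - expR (- t)) * t ^+ m * t ^+ k.+1)).
  by rewrite ler_wpM2l// mulr_ge0 ?exprn_ge0 ?divr_ge0 ?expR_ge0 ?ltW.
have -> : expR (- ((1 + x) * t)) / (1 - expR (- t)) * t ^+ m * t ^+ k.+1 =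
  t ^+ (m + k) * expR (- ((1 + x) * t)) * (t / (1 - expR (- t))).
  by rewrite exprD exprS; ring.
apply: le_trans (ler_wpM2l _ zt) _.
  by rewrite mulr_ge0 ?exprn_ge0 ?expR_ge0 ?ltW.
by rewrite mulrDr mulr1 exprS lerD2l mulrC mulrA.
Qed.

Theorem theorem1 (R : realType) (k : nat) (v : k.-tuple nat) (m : nat)
    (p x : R) (hk : (0 < k)%N) (hv : forall i : 'I_k, (0 < tnth v i)%N)
    (hp : 1 <= p) (hx : 0 < x + 1) :
  let F (n : k.-tuple nat) : R :=
    let nk := last 0%N n in
    euler_beta nk%:R (1 + x) *
      modified_bell m (fun s => harmonic_shift nk s x) /
      (p ^+ nk * tuple_weight v n) in
  summable (@increasing_tuples k) (EFin \o F) /\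
  mzeta v p m.+1%:R x = (rsum (@increasing_tuples k) F)%:C.
Proof.
case: k v hk hv => [//|k] v hk hv F; have p0 : 0 < p by exact: lt_le_trans hp.
have a0 : 0 < 1 + x by rewrite addrC.
have m0 : 0 < m`!%:R :> R by rewrite ltr0n fact_gt0.
pose mu := @lebesgue_measure R.
pose D : set R := `]0, +oo[%classic.
have DP t : D t -> 0 < t by rewrite /D/= in_itv/= andbT.
pose I := (\int[mu]_(t in D)
  (\esum_(n in @increasing_tuples k.+1) (mzeta_term v m p x n t)%:E))%E.
have mt n : measurable_fun D (fun t => (mzeta_term v m p x n t)%:E).
  apply/measurable_EFinP; exact: measurable_mzeta_term.
have t0 n t : D t -> (0 <= (mzeta_term v m p x n t)%:E)%E.
  by move=> /DP t0; rewrite lee_fin mzeta_term_ge0 ?ltW.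
have It n : increasing_tuples n ->
    (\int[mu]_(t in D) (mzeta_term v m p x n t)%:E = (m`!%:R * F n)%:E)%E.
  by move=> Dn; rewrite integral_mzeta_term// ltW.
(* Nonnegativity of the Bell polynomial factor comes for free from the integral. *)
have F0 n : increasing_tuples n -> 0 <= F n.
  move=> Dn; rewrite -(pmulr_rge0 _ m0) -lee_fin -It//.
  by apply: integral_ge0 => t; exact: t0.
have IE : (\esum_(n in @increasing_tuples k.+1) (F n)%:E =
    (m`!%:R^-1)%:E * I)%E.
  rewrite /I integral_esum; first last.
  - by move=> n t _; exact: t0.
  - by move=> n _; exact: mt.
  - exact: measurable_itv.
  rewrite -esumZl; first last.
  - by move=> n; apply: integral_ge0 => t; exact: t0.
  - by rewrite invr_ge0 ltW.
  by apply: eq_esum => n Dn; rewrite It// -EFinM mulKf// gt_eqF.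
have I0 : (0 <= I)%E.
  by apply: integral_ge0 => t Dt; apply: esum_ge0 => n _; exact: t0.
have Ioo : (I < +oo)%E.
  have intA : mu.-integrable D (fun t =>
      (t ^+ (m + k) * expR (- ((1 + x) * t)))%:E +
      (t ^+ (m + k).+1 * expR (- ((1 + x) * t)))%:E)%E.
    by apply: integrableD; [exact: measurable_itv|exact: integrable_powM_expR..].
  apply: le_lt_trans (integrable_lty _ intA); last exact: measurable_itv.
  apply: ge0_le_integral => //.
  - exact: measurable_itv.
  - by move=> t Dt; apply: esum_ge0 => n _; exact: t0.
  - by apply: measurable_esum => [n _|n t _]; [exact: mt|exact: t0].
  - exact: measurable_int intA.
  - by move=> t /DP t0'; apply: esum_mzeta_term_le.
have Ifin : I \is a fin_num by rewrite ge0_fin_numE; [exact: Ioo|exact: I0].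
split.
  rewrite /summable (eq_esum (b := EFin \o F)).
    by rewrite IE lte_mul_pinfty// ?lee_fin ?invr_ge0 ?ltW.
  by move=> n Dn; rewrite /= ger0_norm ?F0.
rewrite ge0_rsum// IE /mzeta gammaS_natr -natr1 addrK.
rewrite (@cintegral_real _ _ _ (fun t =>
  expR (- (x * t)) / (expR t - 1) * t ^+ m *
    polylog v ((1 - expR (- t)) / p))); last first.
  by move=> t /DP t0'; rewrite cpow_natr// -rmorphM/= mulrAC.
rewrite /Rintegral (_ : (\int[lebesgue_measure]_(t in _) _)%E = I); last first.
  apply: eq_integral => t; rewrite inE => /DP t0'.
  by rewrite esum_mzeta_term.
by rewrite fineM//= rmorphM/= fmorphV.
Qed.
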